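(* Let $(\rho,\sigma)$ and $(\rho',\sigma')$ be two pairs of commuting states of a finite-dimensional quantum system, $[\rho,\sigma]=[\rho',\sigma']=0$, with $\sigma,\sigma'$ both of full rank, and suppose $(\rho,\sigma)\succ(\rho',\sigma')$. Let $s_{\min}$ be the smallest eigenvalue of $\sigma$. Then for every integer $n\ge 1$ and every real $b_n\ge n-1$, $$M^{(n)}_{b_n,s_{\min}}(\rho'\|\sigma')\ \ge\ M^{(n)}_{b_n,s_{\min}}(\rho\|\sigma),$$ and, for every integer $n\geq 1$ and every extremal polynomial $F_n$ of degree $n$, $$P^{(n)}_{E,s_{\min}}(\rho'\|\sigma')\ \ge\ P^{(n)}_{E,s_{\min}}(\rho\|\sigma).$$
   Context: $(\rho,\sigma)\succ(\rho',\sigma')$ means that there is a quantum channel (completely positive trace-preserving map) $\mathcal E$ on the system with $\mathcal E(\rho)=\rho'$ and $\mathcal E(\sigma)=\sigma'$. For commuting states $\rho,\sigma$ with $\sigma$ full rank, $x>0$ and a polynomial $H$, $\mathrm{Tr}[\rho H(\ln\rho-\ln\sigma+\ln x)]=\sum_ir_iH(\ln(xr_i/s_i))$, where $r_i,s_i$ are the eigenvalues of $\rho,\sigma$ in a common eigenbasis and terms with $r_i=0$ contribute $0$. Define $M^{(n)}_{b,x}(\rho\|\sigma)=(-1)^n\,\mathrm{Tr}[\rho(\ln\rho-\ln\sigma+\ln x-b)^n]$ and $P^{(n)}_{E,x}(\rho\|\sigma)=-\mathrm{Tr}[\rho F_n(\ln\rho-\ln\sigma+\ln x)]$. Here an extremal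 polynomial $F_n$ of degree $n$ is a polynomial solution with $F_n(0)=0$ of $F_n''(y)+F_n'(y)=G_n(y)$, where $G_n$ has degree $n-1$ and is of the form $\prod_{i=1}^d(y+a_i)^2$ (if $n-1=2d$) or $-y\prod_{i=1}^d(y+a_i)^2$ (if $n-1=2d+1$), with $d\ge 0$, empty product equal to $1$, and all $a_i\ge 0$. The same $F_n$ is used on both sides of the inequality. *)

(* Defs.v *)
From HB Require Import structures.
From mathcomp Require Import all_boot all_order all_algebra.
From mathcomp Require Import spectral complex.
From mathcomp Require Import reals exp.

Set Implicit Arguments.
Unset Strict Implicit.
Unset Printing Implicit Defensive.

Import Order.TTheory GRing.Theory Num.Theory.

Local Open Scope ring_scope.
Local Open Scope complex_scope.
Local Open Scope sesquilinear_scope.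

Section Quantum.
Variable R : realType.
Local Notation C := (R[i]).

(* Since [0 <= z] in R[i] forces z to be real, this entails hermitianness. *)
Definition psdmx n (A : 'M[C]_n) : Prop :=
  forall u : 'rV[C]_n, 0 <= (u *m A *m u^t*) 0 0.

Definition density n (A : 'M[C]_n) : Prop := psdmx A /\ \tr A = 1.

(* id_k (x) E, with C^k (x) C^n viewed as k blocks of size n *)
Definition ampliation n (E : 'M[C]_n -> 'M[C]_n) k
    (X : 'M[C]_(\sum_(i < k) n)) : 'M[C]_(\sum_(i < k) n) :=
  \mxblock_(i < k, j < k) E (submxblock X i j).

Definition completely_positive n (E : 'M[C]_n -> 'M[C]_n) : Prop :=
  forall k (X : 'M[C]_(\sum_(i < k) n)), psdmx X -> psdmx (ampliation E X).

Definition trace_preserving n (E : 'M[C]_n -> 'M[C]_n) : Prop :=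
  forall A, \tr (E A) = \tr A.

Definition pair_convertible n (rho sigma rho' sigma' : 'M[C]_n) : Prop :=
  exists E : {linear 'M[C]_n -> 'M[C]_n},
    [/\ completely_positive E, trace_preserving E, E rho = rho' &
        E sigma = sigma'].

Definition smallest_eigenvalue n (A : 'M[C]_n) (a : R) : Prop :=
  eigenvalue A a%:C /\ forall l : C, eigenvalue A l -> a%:C <= l.

(* Functional calculus of a hermitian matrix; [spectralmx A] has the        *)
(* eigenvectors as rows, so A = P^* diag(spectral_diag A) P.                *)
Definition mxfun n (f : R -> R) (A : 'M[C]_n) : 'M[C]_n :=
  let P := spectralmx A in
  P^t* *m diag_mx (\row_i (f (complex.Re (spectral_diag A 0 i)))%:C) *m P.

(* As [ln 0 = 0], the logarithm of a singular state vanishes on its kernel. *)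
Definition lnmx n (A : 'M[C]_n) : 'M[C]_n := mxfun (@ln R) A.

(* Tr[rho H(ln rho - ln sigma + ln x)]; the eigenvectors of rho with        *)
(* eigenvalue 0 contribute 0 because of the factor rho, and the trace is    *)
(* real for commuting states: see tr_lnpolyE.                               *)
Definition tr_lnpoly d (H : {poly R}) (x : R) (rho sigma : 'M[C]_d.+1) : R :=
  complex.Re (\tr (rho *m horner_mx (lnmx rho - lnmx sigma + (ln x)%:C%:M)
                            (map_poly (real_complex R) H))).

Definition Mn d (n : nat) (b x : R) (rho sigma : 'M[C]_d.+1) : R :=
  (-1) ^+ n * tr_lnpoly (('X - b%:P) ^+ n) x rho sigma.

Definition PE d (F : {poly R}) (x : R) (rho sigma : 'M[C]_d.+1) : R :=
  - tr_lnpoly F x rho sigma.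

(* [n.-1] is 2k or 2k+1 with k = size a; the sign makes G >= 0 on y <= 0.   *)
Definition extremal_rhs (n : nat) (G : {poly R}) : Prop :=
  exists a : seq R,
    [/\ size a = (n.-1)./2, all (fun t => 0 <= t) a &
        G = (if odd n.-1 then - 'X else 1) *
            \prod_(t <- a) ('X + t%:P) ^+ 2].

Definition extremal_poly (n : nat) (F : {poly R}) : Prop :=
  [/\ size F = n.+1, F.[0] = 0 & extremal_rhs n (F^`(2) + F^`())].

Lemma mxfunE n (f : R -> R) (A U : 'M[C]_n) (r : 'I_n -> R) :
    U \is unitarymx -> A = U^t* *m diag_mx (\row_i (r i)%:C) *m U ->
  mxfun f A = U^t* *m diag_mx (\row_i (f (r i))%:C) *m U.
Proof.
move=> Uu AE; have AH : A \is normalmx.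
  apply/orthomx_spectral_subproof; exists (U, \row_i (r i)%:C) => //=.
  by rewrite invmx_unitary.
have /orthomx_spectralP := AH; rewrite /mxfun.
have := spectral_unitarymx A; move: (spectralmx A) (spectral_diag A) => P t.
move=> Pu; rewrite invmx_unitary // => AE'.
have PP : P *m P^t* = 1%:M by apply/unitarymxP.
have UU : U *m U^t* = 1%:M by apply/unitarymxP.
have P'P : P^t* *m P = 1%:M by apply: mulmx1C.
have U'U : U^t* *m U = 1%:M by apply: mulmx1C.
have W_comm : diag_mx t *m (P *m U^t*) =
              P *m U^t* *m diag_mx (\row_i (r i)%:C).
  have -> : diag_mx t *m (P *m U^t*) = P *m A *m U^t*.
    by rewrite AE' !mulmxA PP mul1mx.
  by rewrite AE !mulmxA -!mulmxA UU mulmx1.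
have W_comm' : diag_mx (\row_i (f (complex.Re (t 0 i)))%:C) *m (P *m U^t*) =
    P *m U^t* *m diag_mx (\row_i (f (r i))%:C).
  move: W_comm; move: (P *m U^t*) => W /matrixP W_comm.
  apply/matrixP => i j; have := W_comm i j.
  rewrite !mul_diag_mx !mul_mx_diag !mxE => e.
  have [->|W0] := eqVneq (W i j) 0; first by rewrite mulr0 mul0r.
  move: e; rewrite [RHS]mulrC => /(mulIf W0) ->.
  by rewrite /= mulrC.
transitivity (P^t* *m (diag_mx (\row_i (f (complex.Re (t 0 i)))%:C) *m
                (P *m U^t*)) *m U).
  by rewrite !mulmxA -!mulmxA U'U mulmx1.
by rewrite W_comm' !mulmxA P'P mul1mx.
Qed.

(* In any common eigenbasis (the rows of U) the functional is given by the  *)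
(* eigenvalues r_i of rho and s_i of sigma.                                 *)
Lemma tr_lnpolyE d (H : {poly R}) (x : R) (rho sigma U : 'M[C]_d.+1)
    (r s : 'I_d.+1 -> R) :
    U \is unitarymx ->
    rho = U^t* *m diag_mx (\row_i (r i)%:C) *m U ->
    sigma = U^t* *m diag_mx (\row_i (s i)%:C) *m U ->
    (forall i, 0 <= r i) -> (forall i, 0 < s i) -> 0 < x ->
  \tr (rho *m horner_mx (lnmx rho - lnmx sigma + (ln x)%:C%:M)
         (map_poly (real_complex R) H)) = (tr_lnpoly H x rho sigma)%:C /\
  tr_lnpoly H x rho sigma =
  \sum_i (if r i == 0 then 0 else r i * H.[ln (x * r i / s i)]).
Proof.
move=> Uu rhoE sigmaE r0 s0 x0.
have UU : U *m U^t* = 1%:M by apply/unitarymxP.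
have U'U : U^t* *m U = 1%:M by apply: mulmx1C.
pose y i := ln (r i) - ln (s i) + ln x.
have key : \tr (rho *m horner_mx (lnmx rho - lnmx sigma + (ln x)%:C%:M)
         (map_poly (real_complex R) H)) =
  (\sum_i (if r i == 0 then 0 else r i * H.[ln (x * r i / s i)]))%:C.
  have -> : lnmx rho - lnmx sigma + (ln x)%:C%:M =
            invmx U *m diag_mx (\row_i (y i)%:C) *m U.
    rewrite /lnmx (mxfunE _ Uu rhoE) (mxfunE _ Uu sigmaE).
    have -> : (ln x)%:C%:M = U^t* *m (ln x)%:C%:M *m U :> 'M_d.+1.
      by rewrite mul_mx_scalar -scalemxAl U'U scalemx1.
    rewrite invmx_unitary // -mulmxBl -mulmxBr -mulmxDl -mulmxDr.
    congr (_ *m _ *m _); apply/matrixP => i j; rewrite !mxE.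
    by case: (i == j); rewrite ?mulr1n ?mulr0n /y ?rmorphD ?rmorphN ?subr0 ?addr0.
  rewrite horner_mx_uconjC ?unitarymx_unit // horner_mx_diag invmx_unitary //.
  rewrite rhoE !mulmxA -!mulmxA [U *m (U^t* *m _)]mulmxA UU mul1mx.
  rewrite mxtrace_mulC -!mulmxA UU mulmx1 mulmx_diag mxtrace_diag.
  rewrite rmorph_sum; apply: eq_bigr => i _; rewrite !mxE.
  rewrite horner_map -rmorphM; congr (_%:C).
  have [->|ri0] := eqVneq (r i) 0; first by rewrite mul0r.
  have ri : 0 < r i by rewrite lt_neqAle eq_sym ri0 r0.
  congr (_ * _.[_]); rewrite /y lnM ?posrE ?mulr_gt0 ?invr_gt0 //.
  by rewrite lnM ?posrE // lnV ?posrE // addrC addrA.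
by rewrite /tr_lnpoly key.
Qed.

End Quantum.

(* Main.v *)
Require Import Defs.
From mathcomp Require Import all_boot all_order all_algebra.
From mathcomp Require Import spectral complex ring lra.
From mathcomp Require Import reals topology normedtype.
From mathcomp Require Import sequences derive exp.

(* The channel acts on the eigenvalues of the commuting pairs as a           *)
(* stochastic matrix, so both inequalities are instances of the monotonicity *)
(* of the f-divergence [sum_i s_i f(r_i / s_i)] of a concave function        *)
(* [f v = v H(ln (x v))]. With [y = ln (x v)] one has                        *)
(* [v f''(v) = H''(y) + H'(y)], and [x = s_min] forces [x r_i <= s_i], so    *)
(* that only [y <= 0] matters, where [H'' + H' <= 0] for [H = (b - y)^n]     *)
(* with [b >= n - 1] and for [H = - F_n]. At [v = 0] the tangent line        *)
(* inequality of [f] amounts to [H' <= 0] on [y <= 0].                       *)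

Set Implicit Arguments.
Unset Strict Implicit.
Unset Printing Implicit Defensive.

Import Order.TTheory GRing.Theory Num.Theory.

Local Open Scope ring_scope.
Local Open Scope sesquilinear_scope.

(** The quantum content is exhausted by diagonalization: [psd_simul_diag] gives a common eigenbasis
    for each pair, and [channel_stochastic] replaces the channel by a column-stochastic [T] with
    [r' = T r] and [s' = T s].

    The classical inequality is [sum_ln_horner_stochastic]. For each output [j], the tangent of [f]
    at [r' j / s' j] bounds [s i * f (r i / s i)] by a linear expression in [(r i, s i)]; weighting
    by [T j i] and summing over [i] gives exactly [s' j * f (r' j / s' j)].

    By [tr_lnpoly_monotone] both claims thus reduce to two signs on [y <= 0]. For the moments they
    are read off explicit derivatives. For [- F_n] the sign of [H'' + H'] is that of [- G_n], and
    the sign of [H'] follows from it with the integrating factor [exp y]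
    ([horner_ge0_of_addr_deriv]). *)

Section Analysis.
Import numFieldNormedType.Exports.
Variable R : realType.
Implicit Types (f df : R -> R) (p q H : {poly R}).

(** * Monotonicity and growth of polynomials against the exponential *)

Lemma is_derive_ge0_le f df (a b : R) :
    (forall x : R, is_derive x 1 f (df x)) -> a <= b ->
  (forall x, a <= x <= b -> 0 <= df x) -> f a <= f b.
Proof.
move=> fdf ab df0.
have cf : continuous f.
  by move=> x; exact/differentiable_continuous/derivable1_diffP/ex_derive.
have [c + e] := MVT_segment ab (fun x _ => fdf x) (continuous_subspaceT cf).
rewrite in_itv /= => cab.
by rewrite -subr_ge0 e mulr_ge0 ?df0 ?subr_ge0.
Qed.

Lemma is_derive_le0_le f df (a b : R) :
    (forall x : R, is_derive x 1 f (df x)) -> a <= b ->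
  (forall x, a <= x <= b -> df x <= 0) -> f b <= f a.
Proof.
move=> fdf ab df0; rewrite -lerN2.
apply: (is_derive_ge0_le (fun x => is_deriveN (fdf x)) ab) => x xab.
by rewrite oppr_ge0 df0.
Qed.

Lemma is_derive_expR_horner q (x : R) :
  is_derive x 1 (fun z => expR z * q.[z]) (expR x * (q + q^`()).[x]).
Proof.
have -> : expR x * (q + q^`()).[x] = expR x *: q^`().[x] + q.[x] *: expR x.
  by rewrite hornerD /GRing.scale /=; ring.
exact: (@is_deriveM _ _ expR (horner q)).
Qed.

Lemma is_derive_horner_expR p q (x : R) :
  is_derive x 1 (fun z => p.[z] - expR z * q.[z])
    (p^`().[x] - expR x * (q + q^`()).[x]).
Proof.
exact: (@is_deriveB _ _ _ (horner p) _ x 1 _ _ (is_derive_poly p x)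
  (is_derive_expR_horner q x)).
Qed.

(** Induction on the size: once [p'] is below [c / 2 * exp], the difference [p - c / 2 * exp] no
    longer increases, and the other half of [c] absorbs its bound. *)
Lemma horner_le_expR p c : 0 < c ->
  exists2 t0, 0 <= t0 & forall t, t0 <= t -> p.[t] <= c * expR t.
Proof.
elim: {p}_.+1 {-2}p c (ltnSn (size p)) => // m IHm p c pm c0.
have [p0|p0] := leqP (size p) 0.
  exists 0 => // t _; move: p0; rewrite size_poly_leq0 => /eqP ->.
  by rewrite horner0 mulr_ge0 ?expR_ge0 ?ltW.
have c20 : 0 < c / 2 by rewrite divr_gt0.
have pm' : (size p^`() < m)%N.
  have := lt_size_deriv (_ : p != 0); rewrite -size_poly_gt0 p0 => /(_ isT).
  by move=> /leq_trans; apply.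
have [t0 t00 ht0] := IHm _ _ pm' c20.
pose K := p.[t0].
(* Beyond [K / (c / 2)] the constant [K] is at most [c / 2 * t], hence at most [c / 2 * expR t]. *)
exists (Num.max t0 (K / (c / 2))); first by rewrite le_max t00.
move=> t; rewrite ge_max => /andP[t0t Kt].
have le_K : p.[t] - expR t * (c / 2)%:P.[t] <= K.
  apply: (@le_trans _ _ (p.[t0] - expR t0 * (c / 2)%:P.[t0])); last first.
    by rewrite hornerC gerBl mulr_ge0 ?expR_ge0 ?ltW.
  apply: (is_derive_le0_le (is_derive_horner_expR p (c / 2)%:P) t0t).
  move=> x /andP[t0x _]; rewrite derivC addr0 hornerC subr_le0 mulrC.
  exact: ht0.
have : K <= c / 2 * expR t.
  rewrite -ler_pdivrMl // mulrC (le_trans Kt) // (le_trans _ (expR_ge1Dx _)) //.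
  by rewrite lerDr.
move: le_K; rewrite hornerC; nra.
Qed.

(* [exp(z) q(z)] is nondecreasing on the half-line and tends to 0 at -oo. *)
Lemma horner_ge0_of_addr_deriv q :
    (forall z, z <= 0 -> 0 <= (q + q^`()).[z]) ->
  forall z, z <= 0 -> 0 <= q.[z].
Proof.
move=> qq z z0; rewrite leNgt; apply/negP => qz.
pose c := - (expR z * q.[z]).
have c0 : 0 < c / 2 by rewrite divr_gt0 // oppr_gt0 pmulr_rlt0 // expR_gt0.
(* Far to the left [exp(z) q(z)] is at least [- c / 2], whereas monotonicity keeps it below its
   value [- c] at the given point. *)
have [t0 t00 ht0] := horner_le_expR (- (q \Po (- 'X))) c0.
pose t := Num.max t0 (- z).
have /ht0 : t0 <= t by rewrite le_max lexx.
have tz : - t <= z by rewrite lerNl le_max lexx orbT.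
rewrite hornerN horner_comp hornerN hornerX => qt.
have {tz} : expR (- t) * q.[- t] <= - c.
  rewrite /c opprK; apply: (is_derive_ge0_le (is_derive_expR_horner q) tz).
  by move=> x /andP[_ xz]; rewrite mulr_ge0 ?expR_ge0 // qq ?(le_trans xz).
rewrite expRN mulrC ler_pdivrMr ?expR_gt0 // => h.
have := expR_gt0 t; nra.
Qed.

(** * Tangent lines and the classical data-processing inequality *)

Section Tangent.
Variable H : {poly R}.
Hypothesis H2 : forall z, z <= 0 -> (H^`() + H^`(2)).[z] <= 0.

(* Minimality at [z = y] of [H(z) + H'(z) - exp(z - y) H'(z)], whose        *)
(* derivative is [(1 - exp(z - y)) (H'(z) + H''(z))].                       *)
Lemma expR_horner_tangent y z : y <= 0 -> z <= 0 ->
  expR y * H.[y] <= expR y * (H + H^`()).[z] - expR z * H^`().[z].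
Proof.
move=> y0 z0.
pose p := expR y *: (H + H^`()).
have dp x : p^`().[x] - expR x * (H^`() + H^`()^`()).[x] =
    (expR x - expR y) * - (H^`() + H^`(2)).[x].
  by rewrite /p derivZ derivD hornerZ -[H^`(2)]/(H^`()^`()); ring.
suff : p.[y] - expR y * H^`().[y] <= p.[z] - expR z * H^`().[z].
  by rewrite /p !hornerZ !hornerD; lra.
have [yz|zy] := leP y z.
  apply: (is_derive_ge0_le (is_derive_horner_expR p H^`()) yz).
  move=> x /andP[yx xz]; rewrite dp mulr_ge0 ?subr_ge0 ?ler_expR //.
  by rewrite oppr_ge0 H2 // (le_trans xz).
apply: (is_derive_le0_le (is_derive_horner_expR p H^`()) (ltW zy)).
move=> x /andP[zx xy]; rewrite dp mulr_le0_ge0 ?subr_le0 ?ler_expR //.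
by rewrite oppr_ge0 H2 // (le_trans xy).
Qed.

Hypothesis H1 : forall z, z <= 0 -> H^`().[z] <= 0.

(* Tangent line inequality at the point [u] for the perspective of the      *)
(* concave function [v |-> v H(ln (x v))].                                  *)
Lemma ln_horner_tangent (x r s u : R) :
    0 < x -> 0 <= r -> 0 < s -> x * r <= s -> 0 < u -> x * u <= 1 ->
  (if r == 0 then 0 else r * H.[ln (x * r / s)]) <=
  r * (H + H^`()).[ln (x * u)] - s * u * H^`().[ln (x * u)].
Proof.
move=> x0 r0 s0 rs u0 xu.
have xu0 : 0 < x * u by rewrite mulr_gt0.
have z0 : ln (x * u) <= 0 by rewrite ln_le0.
have [->|rn0] := eqVneq r 0.
  by rewrite mul0r sub0r oppr_ge0 pmulr_rle0 ?mulr_gt0 // H1.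
have {rn0}r0 : 0 < r by rewrite lt_neqAle eq_sym rn0.
have y0 : ln (x * r / s) <= 0 by rewrite ln_le0 // ler_pdivrMr // mul1r.
have := expR_horner_tangent y0 z0.
rewrite !lnK ?posrE ?divr_gt0 ?mulr_gt0 // => h.
(* Multiplying by [s / x] turns [exp y = x r / s] into [r] and [exp z = x u] into [s u]. *)
have xs : 0 < s / x by rewrite divr_gt0.
move: h; rewrite -(ler_pM2l xs).
have e a : s / x * (x * r / s * a) = r * a by field; rewrite !gt_eqF.
have e' a : s / x * (x * u * a) = s * u * a by field; rewrite !gt_eqF.
by rewrite mulrBr !e e'.
Qed.

(* Concavity is only available on [v <= 1 / x], whence [x * r i <= s i].    *)
Lemma sum_ln_horner_stochastic (I J : finType) (T : J -> I -> R)
    (x : R) (r s : I -> R) (r' s' : J -> R) :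
    0 < x -> (forall j i, 0 <= T j i) -> (forall i, \sum_j T j i = 1) ->
    (forall i, 0 <= r i) -> (forall i, 0 < s i) -> (forall i, x * r i <= s i) ->
    (forall j, r' j = \sum_i T j i * r i) ->
    (forall j, s' j = \sum_i T j i * s i) -> (forall j, 0 < s' j) ->
  \sum_i (if r i == 0 then 0 else r i * H.[ln (x * r i / s i)]) <=
  \sum_j (if r' j == 0 then 0 else r' j * H.[ln (x * r' j / s' j)]).
Proof.
move=> x0 T0 T1 r0 s0 rs r'E s'E s'0.
pose h i := if r i == 0 then 0 else r i * H.[ln (x * r i / s i)].
rewrite -[leLHS]/(\sum_i h i).
have -> : \sum_i h i = \sum_j \sum_i T j i * h i.
  by rewrite exchange_big; apply: eq_bigr => i _; rewrite -mulr_suml T1 mul1r.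
apply: ler_sum => j _.
have r'0 : 0 <= r' j by rewrite r'E sumr_ge0 // => i _; rewrite mulr_ge0.
have [r'j|r'j] := eqVneq (r' j) 0.
  have /psumr_eq0P Tr : \sum_i T j i * r i = 0 by rewrite -r'E.
  rewrite big1 // => i _.
  have /eqP := Tr (fun i _ => mulr_ge0 (T0 j i) (r0 i)) i isT.
  by rewrite mulf_eq0 /h => /orP[/eqP ->|->]; rewrite ?mul0r ?mulr0.
have {r'j}r'0 : 0 < r' j by rewrite lt_neqAle eq_sym r'j.
pose p := r' j / s' j.
have p0 : 0 < p by rewrite divr_gt0.
have xp : x * p <= 1.
  rewrite /p mulrA ler_pdivrMr // mul1r r'E s'E mulr_sumr.
  by apply: ler_sum => i _; rewrite mulrCA ler_wpM2l.
(* The tangent of [f] at [p] is [v |-> A v - B]. *)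
pose A := (H + H^`()).[ln (x * p)]; pose B := p * H^`().[ln (x * p)].
apply: (@le_trans _ _ (\sum_i T j i * (r i * A - s i * B))).
  apply: ler_sum => i _; rewrite ler_wpM2l // /B mulrA.
  exact: ln_horner_tangent.
have -> : \sum_i T j i * (r i * A - s i * B) = r' j * A - s' j * B.
  rewrite r'E s'E !mulr_suml -sumrB; apply: eq_bigr => i _.
  by rewrite mulrBr !mulrA.
rewrite /B [s' j * _]mulrA [s' j * p]mulrC divfK ?gt_eqF // -mulrA -/p.
by rewrite -mulrBr /A hornerD addrK.
Qed.

End Tangent.
End Analysis.

(** * Simultaneous diagonalization and positive trace-preserving maps *)

Section Matrices.
Variable C : numClosedFieldType.

Lemma mxform_delta n (A : 'M[C]_n) i j (a : C) :
  let u := delta_mx 0 i + a *: delta_mx 0 j : 'rV_n in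
  (u *m A *m u^t*) 0 0 = A i i + a^* * A i j + a * (A j i + a^* * A j j).
Proof.
have m k l : delta_mx 0 k *m A *m (delta_mx 0 l : 'rV[C]_n)^t* = (A k l)%:M.
  have -> : (delta_mx 0 l : 'rV[C]_n)^t* = delta_mx l 0.
    by apply/matrixP => x y; rewrite !mxE conjC_nat andbC.
  by rewrite -rowE -colE [LHS]mx11_scalar !mxE.
rewrite /= linearD map_mxD linearZ map_mxZ /= mulmxDl !mulmxDr !mulmxDl.
by rewrite -!scalemxAl -!scalemxAr !m !mxE eqxx !mulr1n; ring.
Qed.

Lemma psd_trig_diag n (A : 'M[C]_n) :
    (forall u : 'rV[C]_n, 0 <= (u *m A *m u^t*) 0 0) -> is_trig_mx A ->
  is_diag_mx A.
Proof.
move=> A0 /is_trig_mxP At.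
have Aii i : A i i \is Num.real.
  have := A0 (delta_mx 0 i + 0 *: delta_mx 0 i).
  by rewrite mxform_delta conjC0 !mul0r !addr0 => /ger0_real.
apply/is_diag_mxP => i j; case: ltngtP => // [/At //|ij] _.
(* With [A j i = 0], this vector makes the form a real number plus ['i * |A i j|^2]; since the form
   is real, [A i j] vanishes. *)
have := A0 (delta_mx 0 j + ((A i j)^* * 'i) *: delta_mx 0 i).
rewrite mxform_delta (At _ _ ij) mulr0 addr0 mulrDr mulrA -normCK.
rewrite [_ * 'i * _]mulrAC [(A i j)^* * A i j]mulrC -normCK => /ger0_real.
rewrite addrCA rpredDr; last first.
  by rewrite rpredD ?rpredM ?rpredX ?normr_real ?Aii.
set b := `|A i j| => bi.
have : ('i * b ^+ 2)^* = 'i * b ^+ 2 by apply/CrealP; rewrite mulrC.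
rewrite rmorphM /= conjCi (CrealP _) ?rpredX ?normr_real // mulNr => /eqP.
rewrite eq_sym -subr_eq0 opprK -mulr2n mulrn_eq0 mulf_eq0 (negPf (neq0Ci C)) /=.
by rewrite expf_eq0 /= normr_eq0 => /eqP.
Qed.

(** Commuting matrices are triangular in a common unitary basis; the change of basis preserves
    positivity, and a positive triangular matrix is diagonal. *)
Lemma psd_simul_diag n (A B : 'M[C]_n) :
    (forall u : 'rV[C]_n, 0 <= (u *m A *m u^t*) 0 0) ->
    (forall u : 'rV[C]_n, 0 <= (u *m B *m u^t*) 0 0) -> A *m B = B *m A ->
  exists U : 'M[C]_n, exists a b : 'rV[C]_n,
    [/\ U \is unitarymx, A = U^t* *m diag_mx a *m U,
        B = U^t* *m diag_mx b *m U, forall i, 0 <= a 0 i &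
        forall i, 0 <= b 0 i].
Proof.
move=> A0 B0 /cotrigonalization2[U Uu /andP[AU BU]].
have key (X : 'M[C]_n) : (forall u : 'rV[C]_n, 0 <= (u *m X *m u^t*) 0 0) ->
    similar_trig U X -> exists2 a : 'rV[C]_n,
      X = U^t* *m diag_mx a *m U & forall i, 0 <= a 0 i.
  rewrite /similar_to conjymx // => X0 XU.
  have Y0 (u : 'rV[C]_n) : 0 <= (u *m (U *m X *m U^t*) *m u^t*) 0 0.
    by have := X0 (u *m U); rewrite trmx_mul map_mxM !mulmxA.
  have /is_diag_mxP XD := psd_trig_diag Y0 XU.
  exists (\row_i (U *m X *m U^t*) i i) => [|i]; last first.
    by rewrite mxE; have := Y0 (delta_mx 0 i + 0 *: delta_mx 0 i);
      rewrite mxform_delta conjC0 !mul0r !addr0.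
  have -> : diag_mx (\row_i (U *m X *m U^t*) i i) = U *m X *m U^t*.
    apply/matrixP => i j; rewrite [LHS]mxE [(\row_i _) 0 _]mxE.
    by have [->|ij] := eqVneq i j; rewrite ?mulr1n // mulr0n XD.
  have U'U : U^t* *m U = 1%:M by apply/mulmx1C/unitarymxP.
  by rewrite !mulmxA U'U mul1mx -mulmxA U'U mulmx1.
have [a Aa a0] := key _ A0 AU; have [b Bb b0] := key _ B0 BU.
by exists U, a, b.
Qed.

Lemma mxform_mxblock1 n (A : 'M[C]_n) (w : 'rV[C]_(\sum_(i < 1) n)) :
  w *m (\mxblock_(i < 1, j < 1) A) *m w^t* =
  submxrow w ord0 *m A *m (submxrow w ord0)^t*.
Proof.
rewrite -{1 2}[w]submxrowK.
have -> : (\mxrow_i submxrow w i)^t* = \mxcol_i (submxrow w i)^t*.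
  by apply/matrixP => i j; rewrite !mxE.
by rewrite mul_mxrow_mxblock mul_mxrow_mxcol !big_ord1.
Qed.

(** Bridges the dimension [\sum_(i < 1) n] and [n], so that the case [k = 1] of complete positivity
    yields plain positivity. *)
Lemma psd_mxblock1 n (A : 'M[C]_n) :
  (forall w : 'rV_(\sum_(i < 1) n),
     0 <= (w *m (\mxblock_(i < 1, j < 1) A) *m w^t*) 0 0) <->
  (forall u : 'rV[C]_n, 0 <= (u *m A *m u^t*) 0 0).
Proof.
split=> A0 u; last by rewrite mxform_mxblock1.
by have := A0 (\mxrow_i (fun=> u) i); rewrite mxform_mxblock1 mxrowK.
Qed.

Lemma mxtrace_unitary_conj n (U A : 'M[C]_n) :
  U \is unitarymx -> \tr (U^t* *m A *m U) = \tr A.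
Proof. by move=> /unitarymxP UU; rewrite mxtrace_mulC mulmxA UU mul1mx. Qed.

Lemma eigenvalue_unitary_diag n (U : 'M[C]_n) (a : 'rV[C]_n) l :
    U \is unitarymx ->
  reflect (exists i, l = a 0 i) (eigenvalue (U^t* *m diag_mx a *m U) l).
Proof.
move=> Uu; have UU : U *m U^t* = 1%:M by apply/unitarymxP.
have U'U : U^t* *m U = 1%:M by apply: mulmx1C.
apply: (iffP eigenvalueP) => [[v vE v0]|[i ->]].
  have w0 : v *m U^t* != 0.
    apply: contraNneq v0 => w0.
    by rewrite -[v]mulmx1 -U'U mulmxA w0 mul0mx.
  have [i wi] : exists i, (v *m U^t*) 0 i != 0.
    by have /rV0Pn := w0.
  exists i; apply: (mulIf wi).
  have : (v *m U^t*) *m diag_mx a = l *: (v *m U^t*).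
    by rewrite scalemxAl -vE !mulmxA mulmxtVK.
  move=> /matrixP/(_ 0 i); rewrite mul_mx_diag !mxE => <-.
  by rewrite mulrC.
exists (row i U).
  rewrite -row_mul !mulmxA UU mul1mx mul_diag_mx.
  by apply/rowP => j; rewrite !mxE.
apply/eqP => Ui; have /matrixP/(_ i i) := UU.
rewrite !mxE eqxx big1 => [/eqP|j _]; first by rewrite eq_sym oner_eq0.
by have /rowP/(_ j) := Ui; rewrite !mxE => ->; rewrite mul0r.
Qed.

(* The transition matrix is [T j i = <v_j| E(|u_i><u_i|) |v_j>], where u    *)
(* and v are the eigenbases of the inputs and outputs.                      *)
Lemma positive_map_stochastic n (E : {linear 'M[C]_n -> 'M[C]_n})
    (U V : 'M[C]_n) :
    (forall A, (forall u : 'rV[C]_n, 0 <= (u *m A *m u^t*) 0 0) ->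
       forall u : 'rV[C]_n, 0 <= (u *m E A *m u^t*) 0 0) ->
    (forall A, \tr (E A) = \tr A) -> U \is unitarymx -> V \is unitarymx ->
  exists T : 'I_n -> 'I_n -> C,
    [/\ forall j i, 0 <= T j i, forall i, \sum_j T j i = 1 &
      forall a b : 'rV[C]_n,
        E (U^t* *m diag_mx a *m U) = V^t* *m diag_mx b *m V ->
        forall j, b 0 j = \sum_i T j i * a 0 i].
Proof.
move=> Epos Etr Uu Vu; have VV : V *m V^t* = 1%:M by apply/unitarymxP.
have V'V : V^t* *m V = 1%:M by apply: mulmx1C.
pose Q i := U^t* *m delta_mx i i *m U.
exists (fun j i => (V *m E (Q i) *m V^t*) j j); split.
- move=> j i; have Q0 (u : 'rV[C]_n) : 0 <= (u *m Q i *m u^t*) 0 0.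
    have -> : u *m Q i *m u^t* = (u *m U^t*) *m delta_mx i i *m (u *m U^t*)^t*.
      by rewrite trmx_mul map_mxM trmxCK !mulmxA.
    (* Writing the projector as a column times a row turns the form into a squared modulus. *)
    rewrite -[delta_mx i i](mul_delta_mx (0 : 'I_1)) mulmxA -colE -mulmxA -rowE.
    by rewrite !mxE big_ord1 !mxE mul_conjC_ge0.
  have := Epos _ Q0 (row j V).
  have -> : (row j V)^t* = col j (V^t*) by apply/matrixP => x y; rewrite !mxE.
  rewrite -row_mul.
  have -> // : (row j (V *m E (Q i)) *m col j (V^t*)) 0 0 =
      (V *m E (Q i) *m V^t*) j j.
  by rewrite !mxE; apply: eq_bigr => k _; rewrite !mxE.
- move=> i; rewrite -[LHS]/(\tr _) mxtrace_mulC mulmxA V'V mul1mx Etr.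
  rewrite mxtrace_unitary_conj // /mxtrace (bigD1 i) //= mxE !eqxx.
  rewrite big1 ?addr0 //.
  by move=> k /negPf ki; rewrite mxE ki.
- move=> a b Eab j.
  have -> : b 0 j = (V *m E (U^t* *m diag_mx a *m U) *m V^t*) j j.
    by rewrite Eab !mulmxA VV mul1mx -mulmxA VV mulmx1 mxE eqxx mulr1n.
  rewrite diag_mx_sum_delta mulmx_sumr mulmx_suml linear_sum mulmx_sumr.
  rewrite mulmx_suml summxE; apply: eq_bigr => i _.
  by rewrite -scalemxAr -scalemxAl linearZ -scalemxAr -scalemxAl mxE mulrC.
Qed.

End Matrices.

(** * From states and channels to eigenvalues and stochastic matrices *)

Section DataProcessing.
Local Open Scope complex_scope.
Variable R : realType.
Local Notation C := (R[i]).

Lemma ReK_ge0 (z : C) : 0 <= z -> (complex.Re z)%:C = z.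
Proof. by case: z => a b; rewrite lecE /= => /andP[/eqP -> _]. Qed.

Lemma psd_commuting_diag n (A B : 'M[C]_n) :
    psdmx A -> psdmx B -> comm_mx A B ->
  exists U : 'M[C]_n, exists a b : 'I_n -> R,
    [/\ U \is unitarymx, A = U^t* *m diag_mx (\row_i (a i)%:C) *m U,
        B = U^t* *m diag_mx (\row_i (b i)%:C) *m U,
        forall i, 0 <= a i & forall i, 0 <= b i].
Proof.
move=> A0 B0 AB.
have [U [a [b [Uu Aa Bb a0 b0]]]] := psd_simul_diag A0 B0 AB.
exists U, (fun i => complex.Re (a 0 i)), (fun i => complex.Re (b 0 i)).
have -> : \row_i (complex.Re (a 0 i))%:C = a.
  by apply/rowP => i; rewrite mxE ReK_ge0.
have -> : \row_i (complex.Re (b 0 i))%:C = b.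
  by apply/rowP => i; rewrite mxE ReK_ge0.
split=> [|||i|i]; [exact: Uu | exact: Aa | exact: Bb | |].
- by rewrite -lecR ReK_ge0.
- by rewrite -lecR ReK_ge0.
Qed.

Lemma completely_positive_psd n (E : 'M[C]_n -> 'M[C]_n) A :
  completely_positive E -> psdmx A -> psdmx (E A).
Proof.
move=> Ecp /psd_mxblock1 /Ecp; rewrite /ampliation.
under eq_mxblock do rewrite mxblockK.
by move/psd_mxblock1.
Qed.

Lemma channel_stochastic n (E : {linear 'M[C]_n -> 'M[C]_n}) (U V : 'M[C]_n) :
    completely_positive E -> trace_preserving E ->
    U \is unitarymx -> V \is unitarymx ->
  exists T : 'I_n -> 'I_n -> R,
    [/\ forall j i, 0 <= T j i, forall i, \sum_j T j i = 1 &
      forall a b : 'I_n -> R,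
        E (U^t* *m diag_mx (\row_i (a i)%:C) *m U) =
          V^t* *m diag_mx (\row_i (b i)%:C) *m V ->
        forall j, b j = \sum_i T j i * a i].
Proof.
move=> Ecp Etr Uu Vu.
have [T [T0 T1 TE]] := positive_map_stochastic
  (fun A => @completely_positive_psd _ _ A Ecp) Etr Uu Vu.
have TC j i : (complex.Re (T j i))%:C = T j i by rewrite ReK_ge0.
exists (fun j i => complex.Re (T j i)); split.
- by move=> j i; rewrite -lecR TC.
- move=> i; apply: (@complexI R); rewrite rmorph_sum /=.
  by under eq_bigr do rewrite TC.
- move=> a b /TE h j; apply: (@complexI R); have := h j.
  rewrite mxE rmorph_sum => ->; apply: eq_bigr => i _.
  by rewrite rmorphM /= TC mxE.
Qed.

Lemma density_eigenvalue_le1 n (U : 'M[C]_n) (r : 'I_n -> R) :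
    U \is unitarymx -> density (U^t* *m diag_mx (\row_i (r i)%:C) *m U) ->
  (forall i, 0 <= r i) -> forall i, r i <= 1.
Proof.
move=> Uu [_]; rewrite mxtrace_unitary_conj // mxtrace_diag => tr1 r0 i.
have <- : \sum_i r i = 1.
  apply: (@complexI R); rewrite rmorph_sum -[RHS]tr1.
  by apply: eq_bigr => j _; rewrite mxE.
by rewrite (bigD1 i) //= lerDl sumr_ge0.
Qed.

Lemma full_rank_eigenvalue_gt0 n (U : 'M[C]_n) (s : 'I_n -> R) :
    U \is unitarymx -> \rank (U^t* *m diag_mx (\row_i (s i)%:C) *m U) = n ->
  (forall i, 0 <= s i) -> forall i, 0 < s i.
Proof.
move=> Uu rk s0 i; rewrite lt_neqAle s0 andbT eq_sym; apply/eqP => si.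
have /eigenvalueP[v vE v0] :
    eigenvalue (U^t* *m diag_mx (\row_i (s i)%:C) *m U) 0.
  by apply/eigenvalue_unitary_diag => //; exists i; rewrite mxE si.
have An : U^t* *m diag_mx (\row_i (s i)%:C) *m U \in unitmx.
  by rewrite -row_full_unit /row_full rk.
by move/eqP: v0; apply; rewrite -[v](mulmxK An) vE scale0r mul0mx.
Qed.

Lemma tr_lnpolyZ d (c : R) (H : {poly R}) x (rho sigma : 'M[C]_d.+1) :
  tr_lnpoly (c *: H) x rho sigma = c * tr_lnpoly H x rho sigma.
Proof.
rewrite /tr_lnpoly; set L := _ + _%:M; rewrite map_polyZ linearZ /=.
rewrite -scalemxAr mxtraceZ; case: (\tr _) => a b /=.
by rewrite mul0r subr0.
Qed.

(** Common source of both inequalities: [H2] is the concavity of [f] on [v <= 1 / x], and [H1]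
    handles the zero eigenvalues of [rho]. *)
Lemma tr_lnpoly_monotone d (rho sigma rho' sigma' : 'M[C]_d.+1) (x : R)
    (H : {poly R}) :
    density rho -> density sigma -> density rho' -> density sigma' ->
    comm_mx rho sigma -> comm_mx rho' sigma' ->
    \rank sigma = d.+1 -> \rank sigma' = d.+1 ->
    pair_convertible rho sigma rho' sigma' -> smallest_eigenvalue sigma x ->
    (forall z, z <= 0 -> (H^`() + H^`(2)).[z] <= 0) ->
    (forall z, z <= 0 -> H^`().[z] <= 0) ->
  tr_lnpoly H x rho sigma <= tr_lnpoly H x rho' sigma'.
Proof.
move=> dr ds dr' ds' rs rs' rk rk' [E [Ecp Etr Er Es]] [xe xmin] H2 H1.
have [U [r [s [Uu rE sE r0 s0]]]] := psd_commuting_diag dr.1 ds.1 rs.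
have [V [r' [s' [Vu r'E s'E r'0 s'0]]]] := psd_commuting_diag dr'.1 ds'.1 rs'.
rewrite {}sE in ds rk xe xmin Es *; rewrite {}rE in dr Er *.
rewrite {}s'E in ds' rk' Es *; rewrite {}r'E in dr' Er *.
have sp := full_rank_eigenvalue_gt0 Uu rk s0.
have sp' := full_rank_eigenvalue_gt0 Vu rk' s'0.
have r1 := density_eigenvalue_le1 Uu dr r0.
have x0 : 0 < x.
  have /(eigenvalue_unitary_diag _ _ Uu)[k] := xe.
  by rewrite mxE => /complexI ->.
have xs i : x <= s i.
  rewrite -lecR; apply: xmin; apply/(eigenvalue_unitary_diag _ _ Uu).
  by exists i; rewrite mxE.
have [T [T0 T1 TE]] := channel_stochastic Ecp Etr Uu Vu.
rewrite (tr_lnpolyE H Uu erefl erefl r0 sp x0).2.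
rewrite (tr_lnpolyE H Vu erefl erefl r'0 sp' x0).2.
apply: (sum_ln_horner_stochastic H2 H1 x0 T0 T1) => // [i|j|j].
(* The smallest eigenvalue enters here: [x * r i <= x <= s i], as eigenvalues of a state are at most
   1. *)
- by rewrite (le_trans _ (xs i)) // ger_pMr.
- exact: TE Er j.
- exact: TE Es j.
Qed.

End DataProcessing.

(** * Sign conditions for the moments and the extremal polynomials *)

Section Polynomials.
Variable R : realType.
Implicit Types (b z : R) (F G : {poly R}).

Lemma horner_deriv_subX_exp b m z :
  ((b%:P - 'X) ^+ m.+1)^`().[z] = - (m.+1%:R * (b - z) ^+ m).
Proof.
rewrite deriv_exp derivB derivC derivX sub0r mulN1r mulNrn hornerN hornerMn.
by rewrite horner_exp !hornerE /= mulr_natl.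
Qed.

Lemma moment_deriv_le0 b m z : m%:R <= b -> z <= 0 ->
  ((b%:P - 'X) ^+ m.+1)^`().[z] <= 0.
Proof.
move=> mb z0; rewrite horner_deriv_subX_exp oppr_le0 mulr_ge0 ?exprn_ge0 //.
by rewrite subr_ge0 (le_trans z0) // (le_trans _ mb).
Qed.

(** With [n = m + 1 >= 2] the sum is [- n (b - z)^(n-2) (b - z - (n - 1))], so the threshold
    [b >= n - 1] fixes the sign of the last factor. The case [n = 1] is separate, its second
    derivative being 0. *)
Lemma moment_deriv2_le0 b m z : m%:R <= b -> z <= 0 ->
  (((b%:P - 'X) ^+ m.+1)^`() + ((b%:P - 'X) ^+ m.+1)^`(2)).[z] <= 0.
Proof.
move=> mb z0; rewrite hornerD horner_deriv_subX_exp.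
have -> : ((b%:P - 'X) ^+ m.+1)^`(2) = - ((b%:P - 'X) ^+ m)^`() *+ m.+1.
  rewrite -[_^`(2)]/(_^`()^`()) deriv_exp derivB derivC derivX sub0r mulN1r.
  by rewrite derivMn derivN mulNrn.
case: m mb => [|m] mb.
  by rewrite expr0 derivC oppr0 mul0rn horner0 addr0 mulr1 oppr_le0 ler0n.
rewrite hornerMn hornerN horner_deriv_subX_exp opprK exprS.
have t0 : m.+1%:R <= b - z by rewrite (le_trans mb) // lerBrDl gerDr.
have -> : - (m.+2%:R * ((b - z) * (b - z) ^+ m)) +
    m.+1%:R * (b - z) ^+ m *+ m.+2 =
    - (m.+2%:R * (b - z) ^+ m * (b - z - m.+1%:R)) by rewrite -mulr_natl; ring.
rewrite oppr_le0 mulr_ge0 ?subr_ge0 // mulr_ge0 ?exprn_ge0 //.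
exact: le_trans t0.
Qed.

Lemma extremal_rhs_ge0 n G z : extremal_rhs n G -> z <= 0 -> 0 <= G.[z].
Proof.
move=> [a [_ _ ->]] z0; rewrite hornerM mulr_ge0 //.
  by case: odd; rewrite ?hornerN ?hornerX ?hornerC ?oppr_ge0.
rewrite horner_prod prodr_ge0 // => t _.
by rewrite horner_exp sqr_ge0.
Qed.

Lemma MnE d n b x (rho sigma : 'M[R[i]]_d.+1) :
  Mn n b x rho sigma = tr_lnpoly ((b%:P - 'X) ^+ n) x rho sigma.
Proof.
have -> : (b%:P - 'X) ^+ n = (-1) ^+ n *: ('X - b%:P) ^+ n.
  by rewrite -exprZn scaleN1r opprB.
by rewrite tr_lnpolyZ.
Qed.

Lemma PEE d F x (rho sigma : 'M[R[i]]_d.+1) :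
  PE F x rho sigma = tr_lnpoly (- F) x rho sigma.
Proof. by rewrite -scaleN1r tr_lnpolyZ mulN1r. Qed.

End Polynomials.

Theorem mainTheorem8 (R : realType) (d : nat)
    (rho sigma rho' sigma' : 'M[R[i]]_d.+1) (s_min : R) :
    density rho -> density sigma -> density rho' -> density sigma' ->
    comm_mx rho sigma -> comm_mx rho' sigma' ->
    \rank sigma = d.+1 -> \rank sigma' = d.+1 ->
    pair_convertible rho sigma rho' sigma' ->
    smallest_eigenvalue sigma s_min ->
  (forall (n : nat) (b : R), (1 <= n)%N -> n%:R - 1 <= b ->
     Mn n b s_min rho' sigma' >= Mn n b s_min rho sigma) /\
  (forall (n : nat) (F : {poly R}), (1 <= n)%N -> extremal_poly n F ->
     PE F s_min rho' sigma' >= PE F s_min rho sigma).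
Proof.
move=> dr ds dr' ds' rs rs' rk rk' conv smin.
split=> [[|m] b n1 mb|n F _ [_ _ Gn]]; first by discriminate n1.
- rewrite !MnE.
  have {}mb : m%:R <= b by move: mb; rewrite -natr1 addrK.
  apply: (tr_lnpoly_monotone dr ds dr' ds' rs rs' rk rk' conv smin) => z.
    exact: moment_deriv2_le0.
  exact: moment_deriv_le0.
- rewrite !PEE.
  apply: (tr_lnpoly_monotone dr ds dr' ds' rs rs' rk rk' conv smin) => z z0.
    rewrite derivN derivnN -opprD addrC hornerN oppr_le0.
    exact: extremal_rhs_ge0 Gn z0.
  (* Here [q = F'] satisfies [q + q' = G >= 0] on the half-line, whence [F' >= 0] there. *)
  rewrite derivN hornerN oppr_le0.
  apply: horner_ge0_of_addr_deriv z0 => y y0; rewrite addrC.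
  exact: extremal_rhs_ge0 Gn y0.
Qed.
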